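(* Let $\mathcal{G}^C=(\mathcal{V}^C,\mathcal{E}^C)$ be an admissible cluster-DAG. Let $\mathcal{G}^m_{\min}$ be its corresponding minimal compatible graph and let $\mathcal{G}^{m,C}_{\mathrm{u}}$ be its corresponding unfolded graph. Let $\mathcal{X}^C,\mathcal{Y}^C,\mathcal{Z}^C$ be pairwise disjoint subsets of nodes of $\mathcal{G}^C$. Then the following properties are equivalent: 1. It is not the case that $\mathcal{X}^m$ and $\mathcal{Y}^m$ are d-separated by $\mathcal{Z}^m$ in every $\mathcal{G}^m\in\mathcal{C}(\mathcal{G}^C)$; that is, there exists $\mathcal{G}^m\in\mathcal{C}(\mathcal{G}^C)$ in which $\mathcal{X}^m$ and $\mathcal{Y}^m$ are not d-separated by $\mathcal{Z}^m$. 2. $\mathcal{G}^{m,C}_{\mathrm{u}}$ contains a structure of interest $\sigma^m$ that connects $\mathcal{X}^m$ and $\mathcal{Y}^m$ under $\mathcal{Z}^m$ such that $\mathcal{G}^m_{\min}\cup\sigma^m$ is acyclic.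
   Context: A mixed graph is a finite graph with directed edges ($\rightarrow$) and bidirected edges ($\leftrightarrow$); both kinds may be present between the same two vertices. It is acyclic if it has no directed cycle. An ADMG is an acyclic mixed graph all of whose edges join distinct vertices. Unions of graphs are taken on vertices and edges. Cluster-DAG: a finite mixed graph $\mathcal{G}^C=(\mathcal{V}^C,(\mathcal{E}^C_D,\mathcal{E}^C_B))$ whose nodes are pairwise disjoint non-empty clusters of variables; a cluster $V$ of size $\#V\ge 1$ is $V=\{V_1,\dots,V_{\#V}\}$. Directed cycles in $\mathcal{G}^C$ and self-loops of both types (directed and bidirected) are allowed. Compatible micro graph: an ADMG $\mathcal{G}^m=(\mathcal{V}^m,(\mathcal{E}^m_D,\mathcal{E}^m_B))$ with $\mathcal{V}^m=\bigcup_{V\in\mathcal{V}^C}\{V_1,\dots,V_{\#V}\}$ such that: for all distinct clusters $A,B$, $A\rightarrow B\in\mathcal{E}^C_D$ iff there are $i,j$ with $A_i\rightarrow B_j\in\mathcal{E}^m_D$; for all distinct clusters $A,B$, $A\leftrightarrow B\in\mathcal{E}^C_B$ iff there are $i,j$ with $A_i\leftrightarrow B_j\in\mathcal{E}^m_B$; for each cluster $A$, the directed self-loop on $A$ is in $\mathcal{E}^C_D$ iff there are distinct $i,j$ with $A_i\rightarrow A_j\in\mathcal{E}^m_D$; for each cluster $A$, the bidirected self-loop on $A$ is in $\mathcal{E}^C_B$ iff there are distinct $i,j$ with $A_i\leftrightarrow A_j\in\mathcal{E}^m_B$. $\mathcal{C}(\mathcal{G}^C)$ is the set of all micro graphs compatible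 with $\mathcal{G}^C$. $\mathcal{G}^C$ is admissible if $\mathcal{C}(\mathcal{G}^C)\ne\emptyset$. For a set $\mathcal{S}^C$ of clusters, $\mathcal{S}^m$ is the set of all variables belonging to the clusters of $\mathcal{S}^C$. Minimal compatible graph $\mathcal{G}^m_{\min}=(\mathcal{V}_{\min},\mathcal{E}_{\min})$: $\mathcal{V}_{\min}=\bigcup_{V\in\mathcal{V}^C}\{V_1,\dots,V_{\#V}\}$, with edges: (1) for each bidirected edge $U\leftrightarrow V$ of $\mathcal{G}^C$ (including $U=V$), all $U_i\leftrightarrow V_j$ with $U_i\neq V_j$; (2) for each directed self-loop on $V$, all $V_i\rightarrow V_j$ with $i<j$; (3) for each directed edge $U\rightarrow V$ with $U\ne V$, the edge $U_1\rightarrow V_{\#V}$. Unfolded graph $\mathcal{G}^{m,C}_{\mathrm{u}}$: the mixed graph with vertex set $\mathcal{V}_{\min}$ and edge set $\mathcal{E}_{\min}\cup\mathcal{E}_{\text{to choose}}$, where $\mathcal{E}_{\text{to choose}}$ is the set of all directed edges $U_i\rightarrow V_j$ such that $U\rightarrow V$ is an edge of $\mathcal{G}^C$ and adding $U_i\rightarrow V_j$ to $\mathcal{G}^m_{\min}$ does not create a directed cycle. d-separation: A path is a sequence of distinct vertices joined by consecutive edges. An interior vertex is a collider on it if both adjacent path edges have an arrowhead at it; all other vertices are non-colliders. A path is active given $\mathcal{Z}$ if every collider on it is in $\mathcal{Z}$ or has a descendant in $\mathcal{Z}$, and no non-collider on it is in $\mathcal{Z}$. $\mathcal{X}$ and $\mathcal{Y}$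 are d-separated by $\mathcal{Z}$ if no path between a vertex of $\mathcal{X}$ and a vertex of $\mathcal{Y}$ is active given $\mathcal{Z}$. Structure of interest: an ADMG with a single connected component in which each node $V$ has at most one outgoing arrow (directed edge with tail at $V$), or has two outgoing arrows but no incoming arrow (no directed or bidirected edge with an arrowhead at $V$). $\mathrm{Root}(\sigma)$ is the set of vertices of $\sigma$ with no child in $\sigma$. A structure of interest $\sigma$ connects $\mathcal{X}$ and $\mathcal{Y}$ under $\mathcal{Z}$ in a mixed graph $\mathcal{G}$ if: $\sigma\subseteq\mathcal{G}$ (subgraph); $\sigma$ contains a vertex of $\mathcal{X}$ and a vertex of $\mathcal{Y}$; $\mathrm{Root}(\sigma)\subseteq\mathcal{Z}\cup\mathcal{X}\cup\mathcal{Y}$; and no vertex of $\sigma$ outside $\mathrm{Root}(\sigma)$ belongs to $\mathcal{Z}$. *)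

(* Defs.v *)
From mathcomp Require Import all_boot.

Set Implicit Arguments.
Unset Strict Implicit.
Unset Printing Implicit Defensive.

(* [bid] is stored as a symmetric relation.  The vertex set is explicit because
   structures of interest are subgraphs of graphs over the same type. *)
Record mgraph (T : finType) := MGraph {
  verts : {set T};
  dir : rel T;
  bid : rel T;
  dir_verts : forall x y, dir x y -> (x \in verts) && (y \in verts);
  bid_verts : forall x y, bid x y -> (x \in verts) && (y \in verts);
  bid_sym : symmetric bid
}.

Definition acyclic (T : finType) (e : rel T) : bool :=
  [forall x, forall y, e x y ==> ~~ connect e y x].

Lemma acyclicP (T : finType) (e : rel T) :
  reflect (forall c : seq T, c != [::] -> ~~ cycle e c) (acyclic e).
Proof.
apply: (iffP forallP) => [H [//|x c] _ | H x].
  apply/negP; case: c => [|y c] /=.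
    rewrite andbT => exx; move/forallP: (H x) => /(_ x).
    by rewrite exx connect0.
  case/andP=> exy pyx; move/forallP: (H x) => /(_ y).
  rewrite exy /= => /connectP[]; exists (rcons c x) => //.
  by rewrite last_rcons.
apply/forallP=> y; apply/implyP=> exy; apply/connectP=> -[p pyp xE].
have /negP := H (y :: p) isT; apply.
by rewrite /= rcons_path pyp -xE.
Qed.

Section MixedGraphs.
Variable T : finType.
Implicit Types (G H : mgraph T) (X Y Z : {set T}).

Definition admg G : Prop :=
  acyclic (dir G) /\ (forall x, ~~ dir G x x && ~~ bid G x x).

Definition subgraph H G : Prop :=
  [/\ verts H \subset verts G, subrel (dir H) (dir G)
    & subrel (bid H) (bid G)].

Lemma union_verts G H (r s : rel T) :
    (forall x y, r x y -> (x \in verts G) && (y \in verts G)) ->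
    (forall x y, s x y -> (x \in verts H) && (y \in verts H)) ->
  forall x y, r x y || s x y ->
    (x \in verts G :|: verts H) && (y \in verts G :|: verts H).
Proof.
move=> hr hs x y /orP[/hr|/hs] /andP[hx hy]; by rewrite !inE hx hy ?orbT.
Qed.

Lemma union_bid_sym G H : symmetric [rel x y | bid G x y || bid H x y].
Proof. by move=> x y /=; rewrite bid_sym [bid H x y]bid_sym. Qed.

Definition union G H : mgraph T :=
  @MGraph T (verts G :|: verts H)
    [rel x y | dir G x y || dir H x y]
    [rel x y | bid G x y || bid H x y]
    (union_verts (@dir_verts _ G) (@dir_verts _ H))
    (union_verts (@bid_verts _ G) (@bid_verts _ H))
    (@union_bid_sym G H).

(* Two vertices may be joined by several edges, so a path records the edge it
   uses at each step: it is a start vertex [x] together with a sequence of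
   pairs (kind of the edge traversed, vertex reached). *)
Inductive edge_kind := Forward | Backward | Bidirected.

Definition edge G (k : edge_kind) : rel T :=
  match k with
  | Forward => dir G
  | Backward => fun x y => dir G y x
  | Bidirected => bid G
  end.

Definition head_at_source (k : edge_kind) : bool :=
  if k is Forward then false else true.

Definition head_at_target (k : edge_kind) : bool :=
  if k is Backward then false else true.

Fixpoint walk G (x : T) (p : seq (edge_kind * T)) : bool :=
  if p is (k, y) :: q then edge G k x y && walk G y q else true.

Definition pverts (x : T) (p : seq (edge_kind * T)) : seq T :=
  x :: [seq s.2 | s <- p].

Definition pend (x : T) (p : seq (edge_kind * T)) : T :=
  last x [seq s.2 | s <- p].

Definition is_path G (x : T) (p : seq (edge_kind * T)) : bool :=
  [&& x \in verts G, walk G x p & uniq (pverts x p)].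

(* [zip p (behead p)] lists the pairs of consecutive steps; the interior vertex
   between two such steps is the one reached by the first. *)
Definition colliders (p : seq (edge_kind * T)) : seq T :=
  [seq s.1.2 | s <- zip p (behead p)
             & head_at_target s.1.1 && head_at_source s.2.1].

(* [connect] is reflexive, so the first clause covers a collider in [Z]. *)
Definition active G Z (x : T) (p : seq (edge_kind * T)) : Prop :=
  (forall v, v \in colliders p -> exists2 z, z \in Z & connect (dir G) v z) /\
  (forall v, v \in pverts x p -> v \notin colliders p -> v \notin Z).

Definition dsep G X Y Z : Prop :=
  forall x p, x \in X -> pend x p \in Y -> is_path G x p -> ~ active G Z x p.

Definition adj G : rel T := [rel x y | [|| dir G x y, dir G y x | bid G x y]].

Definition outdeg G (v : T) : nat := #|[set w | dir G v w]|.

Definition no_incoming G (v : T) : bool :=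
  [forall w, ~~ dir G w v && ~~ bid G w v].

Definition structure_of_interest G : Prop :=
  [/\ admg G,
      n_comp (adj G) (verts G) = 1
    & {in verts G, forall v,
        (outdeg G v <= 1) || (outdeg G v == 2) && no_incoming G v}].

Definition Root G : {set T} :=
  [set v in verts G | [forall w, ~~ dir G v w]].

Definition connects G H X Y Z : Prop :=
  [/\ subgraph H G,
      exists2 x, x \in verts H & x \in X,
      exists2 y, y \in verts H & y \in Y,
      Root H \subset Z :|: X :|: Y
    & {in verts H, forall v, v \notin Root H -> v \notin Z}].

End MixedGraphs.

(* The elements of [K] are the clusters; the cluster [A] has [csize A]
   variables. *)
Record cluster_dag (K : finType) := ClusterDag {
  cgraph :> mgraph K;
  csize : K -> nat;
  verts_cgraph : verts cgraph = [set: K];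
  csize_gt0 : forall A, 0 < csize A
}.

Section ClusterDags.
Variables (K : finType) (C : cluster_dag K).

(* Tagging each variable with its cluster makes the clusters disjoint.  Indices
   start at 0: V_1 has index 0 and V_{#V} has index [csize C V - 1]. *)
Definition var : finType := {A : K & 'I_(csize C A)}.

Definition mkvar (A : K) (i : 'I_(csize C A)) : var :=
  Tagged (fun A => 'I_(csize C A)) i.

Definition cluster (v : var) : K := tag v.
Definition index_in (v : var) : nat := tagged v.

Definition micro (S : {set K}) : {set var} := [set v | cluster v \in S].

Definition compatible (G : mgraph var) : Prop :=
  [/\ admg G /\ verts G = [set: var],
      forall A B, A != B ->
        dir C A B <-> exists i j, dir G (@mkvar A i) (@mkvar B j),
      forall A B, A != B ->
        bid C A B <-> exists i j, bid G (@mkvar A i) (@mkvar B j),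
      forall A,
        dir C A A <->
        exists i j, i != j /\ dir G (@mkvar A i) (@mkvar A j)
    & forall A,
        bid C A A <->
        exists i j, i != j /\ bid G (@mkvar A i) (@mkvar A j)].

Definition admissible : Prop := exists G, compatible G.

Definition min_dir : rel var := [rel x y |
  dir C (cluster x) (cluster y) &&
  (if cluster x == cluster y then index_in x < index_in y
   else (index_in x == 0) && ((index_in y).+1 == csize C (cluster y)))].

Definition min_bid : rel var := [rel x y |
  bid C (cluster x) (cluster y) && (x != y)].

Lemma full_verts (r : rel var) x y :
  r x y -> (x \in [set: var]) && (y \in [set: var]).
Proof. by rewrite !inE. Qed.

Lemma min_bid_sym : symmetric min_bid.
Proof. by move=> x y; rewrite /min_bid /= bid_sym eq_sym. Qed.

Definition Gmin : mgraph var :=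
  @MGraph var [set: var] min_dir min_bid
    (@full_verts min_dir) (@full_verts min_bid) min_bid_sym.

(* For an admissible cluster graph [min_dir] is acyclic, so that an added edge
   creates a directed cycle exactly when the enlarged relation has one. *)
Definition to_choose : rel var := [rel x y |
  dir C (cluster x) (cluster y) &&
  acyclic [rel a b | min_dir a b || ((a == x) && (b == y))]].

Definition unf_dir : rel var := [rel x y | min_dir x y || to_choose x y].

Definition Gunf : mgraph var :=
  @MGraph var [set: var] unf_dir min_bid
    (@full_verts unf_dir) (@full_verts min_bid) min_bid_sym.

End ClusterDags.

(* Main.v *)
Require Import Defs.
From mathcomp Require Import all_boot.
From Stdlib Require Classical_Prop.

Set Implicit Arguments.
Unset Strict Implicit.
Unset Printing Implicit Defensive.

(** Why the equivalence holds.

    From a path to a structure.  Permuting the variables inside each cluster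
    keeps a compatible graph compatible and moves neither X, Y nor Z, so the
    indices may be taken to follow a topological order of G.  Every directed edge
    of the minimal graph then goes up in that order too: inside a cluster by the
    choice of indices, and between clusters because it joins the first variable
    of its source to the last variable of its target, which are at least as far
    apart as the two ends of some edge of G.  Hence G, once sorted, is a subgraph
    of the unfolded graph, and the union of the minimal graph with any subgraph
    of G is acyclic.  It remains to find, inside an ADMG with an active path from
    x to y, a structure of interest that connects x and y ([walk_connects]).  Keep
    the vertices that reach X, Y or Z along directed edges whose tails avoid Z,
    with all edges between them except the directed ones with tail in Z.  All
    vertices of the active path are kept, and consecutive ones stay adjacent.  Among
    the subgraphs in which x and y remain connected and every vertex outside X, Y
    and Z keeps a child, take one of minimal size: it is a structure of interest.
    Indeed, if a vertex v has two children, deleting one edge out of v leaves v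
    with a child, so minimality says that each such edge is a cut between x and y;
    there are then exactly two of them.  An edge into v could also be removed,
    along with the strict ancestors of v when it is directed, without separating x
    from y, against minimality ([min_branch]).

    From a structure to a path.  The union of the minimal graph with sigma is
    compatible, as it contains a representative of each edge of the cluster graph
    and nothing else ([compatible_union]).  Follow an undirected path in sigma
    from X to Y.  Each vertex w on it has a sink of sigma below it.  If a sink in
    Y is below w, go down to it and stop; if one in X is, restart the walk from
    that sink, going up to w; otherwise a sink in Z is below w, so that w may be a
    collider.  Tails of edges of sigma are never in Z, so this walk is active
    ([reached_Y]), and excising its loops turns it into an active path
    ([open_walk_shorten]). *)

(** * Acyclic relations and elementary facts on mixed graphs *)

Lemma acyclic_rank (T : finType) (e : rel T) (r : T -> nat) :
  (forall x y, e x y -> r x < r y) -> acyclic e.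
Proof.
move=> er; apply/forallP=> x; apply/forallP=> y; apply/implyP=> /er xy.
apply/connectP=> -[p yp xE]; suff: r y <= r x by rewrite leqNgt xy.
elim: p y yp xE {xy} => [|z p IH] y /=; first by move=> _ ->.
by case/andP=> /er yz zp xE; apply: ltnW (leq_trans yz (IH _ zp xE)).
Qed.

Definition num_anc (T : finType) (e : rel T) (v : T) := #|[set u | connect e u v]|.

Lemma num_anc_lt (T : finType) (e : rel T) x y :
  acyclic e -> e x y -> num_anc e x < num_anc e y.
Proof.
move=> ac xy; apply: proper_card; apply/properP; split.
  apply/subsetP=> u; rewrite !inE => ux; exact: connect_trans ux (connect1 xy).
exists y; rewrite !inE ?connect0 //.
by move/forallP/(_ x)/forallP/(_ y)/implyP: ac; apply.
Qed.

Lemma acyclic_sink (T : finType) (e : rel T) x :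
  acyclic e -> exists2 r, connect e x r & forall y, ~~ e r y.
Proof.
move=> ac; have [r xr mr] := arg_maxnP (num_anc e) (connect0 e x).
exists r => // y; apply/negP=> ry.
have /= := mr y (connect_trans xr (connect1 ry)).
by rewrite /geq /= leqNgt num_anc_lt.
Qed.

Lemma adj_sym (T : finType) (G : mgraph T) : symmetric (adj G).
Proof. by move=> x y; rewrite /adj /= orbCA [bid _ _ _]bid_sym. Qed.

Lemma edge_verts (T : finType) (G : mgraph T) k v w :
  edge G k v w -> (v \in verts G) && (w \in verts G).
Proof.
by case: k => [/dir_verts|/dir_verts|/bid_verts] // /andP[-> ->].
Qed.

Lemma subgraph_trans (T : finType) (G1 G2 G3 : mgraph T) :
  subgraph G1 G2 -> subgraph G2 G3 -> subgraph G1 G3.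
Proof.
move=> [v d b] [v' d' b']; split; first exact: subset_trans v v'.
  by move=> x y /d /d'.
by move=> x y /b /b'.
Qed.

(** * Walks with an active pattern of colliders *)

Section ActiveWalks.
Variables (T : finType) (G : mgraph T) (Z : {set T}).
Implicit Types (x v w : T) (s t : edge_kind * T) (p q : seq (edge_kind * T)).

Definition has_descendant v : bool := [exists z in Z, connect (dir G) v z].

(** The condition that activity puts on the vertex where two consecutive steps
    meet.  Stated position by position, it makes sense for walks that revisit
    vertices.  The start of a walk is handled by a fictitious step before it: an
    initial [Backward] step makes the start a non-collider, hence outside Z. *)
Definition open_step s t : bool :=
  if head_at_target s.1 && head_at_source t.1 then has_descendant s.2
  else s.2 \notin Z.

Lemma has_descendant_dir v w : dir G v w -> has_descendant w -> has_descendant v.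
Proof.
move=> vw /existsP[z /andP[zZ wz]]; apply/existsP; exists z.
by rewrite zZ (connect_trans (connect1 vw) wz).
Qed.

Lemma walk_cat x p q : walk G x (p ++ q) = walk G x p && walk G (pend x p) q.
Proof. by elim: p x => [|[k w] p IH] x //=; rewrite IH andbA. Qed.

Lemma last_pend k x p : (last (k, x) p).2 = pend x p.
Proof. by elim: p k x => [|[k' w] p IH] k x //=; rewrite IH. Qed.

Lemma split_step v p :
  v \in [seq s.2 | s <- p] -> exists p1 k p2, p = p1 ++ (k, v) :: p2.
Proof.
elim: p => [|[k w] p IH] //=; rewrite inE => /orP[/eqP->|/IH[p1 [k' [p2 ->]]]].
  by exists [::], k, p.
by exists ((k, w) :: p1), k', p2.
Qed.

(** Leave x along a tail and follow the arrows: either they never turn, or they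
    turn for the first time at a collider, which is a descendant of x. *)
Lemma has_descendant_of_turn x p :
    walk G x p -> path open_step (Forward, x) p ->
    ~~ all (fun s => ~~ head_at_source s.1) p ->
  has_descendant x.
Proof.
elim: p x => [|[k w] p IH] x //= /andP[xw wp] /andP[].
by case: k xw => //= xw _ okp nF; apply: has_descendant_dir xw (IH _ wp okp nF).
Qed.

(** Loop removal.  When the loop at x is excised, two steps of the walk that did
    not meet before now meet at x.  If x does not become a collider, one of the two
    has a tail at x, so x was already a non-collider.  If x becomes a collider
    without having been one, the loop leaves x by a tail and comes back by a
    tail, so it turns at a collider below x ([has_descendant_of_turn]). *)
Lemma open_walk_shorten k0 x p :
    walk G x p -> path open_step (k0, x) p ->
  exists q, [/\ walk G x q, path open_step (k0, x) q, pend x q = pend x p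
              & uniq (pverts x q)].
Proof.
elim: p k0 x => [|[k w] p IH] k0 x /=; first by exists [::].
case/andP=> xw wp /andP[ok0 okp].
have [q [wq okq eq uq]] := IH _ _ wp okp.
have [xq|xq] := boolP (x \in pverts w q); last first.
  by exists ((k, w) :: q); split=> //=; [rewrite xw|rewrite ok0|rewrite xq].
have [r1 [k' [r2 er]]] := split_step (p := (k, w) :: q) xq.
have wr : walk G x (r1 ++ (k', x) :: r2) by rewrite -er /= xw.
have okr : path open_step (k0, x) (r1 ++ (k', x) :: r2) by rewrite -er /= ok0.
have ur : uniq [seq s.2 | s <- r1 ++ (k', x) :: r2] by rewrite -er.
exists r2; split.
- by move: wr; rewrite walk_cat /= => /and3P[].
- move: okr; rewrite cat_path /= => /and3P[okr1 okl].
  case: r2 er wr ur => [//|[k2 w2] r2] er wr ur /=.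
  case/andP=> ok2 ->; rewrite andbT.
  rewrite /open_step /=; case: ifP => [/andP[h0 h2]|].
    move: ok0 ok2; rewrite /open_step /= h0 h2 andbT /=.
    case hk: (head_at_source k) => //= _.
    case hk': (head_at_target k') => //= _.
    have {}hk : k = Forward by case: (k) hk.
    have {}hk' : k' = Backward by case: (k') hk'.
    subst k k'.
    case: r1 er wr {okr1 okl ur} => [//|s1 r1] [<- er].
    rewrite /= walk_cat => /and3P[_ wr1 /= /andP[wl _]].
    apply: (has_descendant_dir xw).
    apply: (@has_descendant_of_turn _ (rcons r1 (Backward, x))).
    + by rewrite -cats1 walk_cat wr1 /= wl.
    + move: okq; rewrite er => okq; move: okq.
      by rewrite -cat_rcons cat_path => /andP[].
    + by rewrite all_rcons.
  move: ok0 ok2; rewrite /open_step /=; case: (head_at_target k0) => //= _.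
  by case: (head_at_source k2) => //=; rewrite andbF.
- transitivity (pend x ((k, w) :: q)); last exact: eq.
  by rewrite er /pend map_cat last_cat.
- by move: ur; rewrite map_cat cat_uniq => /and3P[].
Qed.

Lemma colliders_cons2 s t p :
  colliders (s :: t :: p) =
  if head_at_target s.1 && head_at_source t.1 then s.2 :: colliders (t :: p)
  else colliders (t :: p).
Proof. by rewrite /colliders /=; case: ifP. Qed.

Lemma colliders_sub p v : v \in colliders p -> v \in [seq s.2 | s <- p].
Proof.
elim: p => [|s [|t p] IH] //; rewrite colliders_cons2 map_cons in_cons.
case: ifP => _; last by move=> /IH ->; rewrite orbT.
by rewrite in_cons => /orP[->//|/IH ->]; rewrite orbT.
Qed.

Lemma open_walk_active x p :
  path open_step (Backward, x) p -> pend x p \notin Z -> active G Z x p.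
Proof.
move=> okp pZ; split.
  case: p okp {pZ} => [|s p] //= /andP[_].
  elim: p s => [|t p IH] s //= /andP[okst okp] v; rewrite colliders_cons2.
  case: ifP => [h|_]; last by apply: IH okp _.
  rewrite in_cons => /orP[/eqP->|]; last by apply: IH okp _.
  by move: okst; rewrite /open_step h => /existsP[z /andP[zZ sz]]; exists z.
suff main : forall k x p, path open_step (k, x) p -> pend x p \notin Z ->
    forall v, v \in [seq s.2 | s <- p] -> v \notin colliders p -> v \notin Z.
  move=> v; rewrite in_cons => /orP[/eqP-> _|]; last exact: main okp pZ v.
  by case: p okp pZ => [//|s p] /= /andP[].
move=> {x p okp pZ} k x p; elim: p k x => [|[k' w] p IH] k x //=.
case/andP=> _ okp pZ v; case: p IH okp pZ => [|t p] IH okp pZ.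
  by rewrite inE => /eqP->.
have IH' := IH _ _ okp pZ v.
rewrite colliders_cons2 in_cons; case: ifP => h; rewrite ?in_cons ?negb_or.
  by case/orP=> [->//|vt /andP[_]]; apply: IH'.
case/orP=> [/eqP-> _|vt]; last exact: IH'.
by move: okp; rewrite /= /open_step h => /andP[].
Qed.

(** Distinctness makes being a collider, which activity tests by membership of
    a vertex in a list, a property of a single position. *)
Lemma active_open_walk x p :
  uniq (pverts x p) -> active G Z x p -> path open_step (Backward, x) p.
Proof.
move=> up [Hc Hn]; case: p up Hc Hn => [//|s p] up Hc Hn.
apply/andP; split.
  apply: Hn; first exact: mem_head.
  by apply: contraL up => /colliders_sub xs; rewrite /= xs.
have {}Hn v : v \in [seq t.2 | t <- s :: p] -> v \notin colliders (s :: p) ->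
    v \notin Z by move=> vs; apply: Hn; rewrite inE vs orbT.
have {x}up : uniq [seq t.2 | t <- s :: p] by case/andP: up.
elim: p s up Hc Hn => [//|t p IH] s /andP[su up] Hc Hn.
rewrite colliders_cons2 in Hc, Hn.
have sc : s.2 \notin colliders (t :: p) by apply: contra su => /colliders_sub.
apply/andP; split.
  rewrite /open_step; case: ifP Hc Hn => h Hc Hn; last first.
    by apply: Hn => //; apply: mem_head.
  have [z zZ sz] := Hc s.2 (mem_head _ _).
  by apply/existsP; exists z; rewrite zZ.
apply: IH => // v vt; first by apply: Hc; case: ifP => // _; rewrite inE vt orbT.
move=> vc; apply: Hn; first by rewrite map_cons in_cons vt orbT.
case: ifP => // _; rewrite in_cons negb_or vc andbT.
by apply: contraNneq su => <-.
Qed.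

End ActiveWalks.

(** * From a connecting structure to an active path *)

Section StructureToPath.
Variables (T : finType) (G H : mgraph T) (X Y Z : {set T}).
Hypotheses (acH : acyclic (dir H)) (subHG : subgraph H G).
Hypotheses (dXZ : [disjoint X & Z]) (dYZ : [disjoint Y & Z]).
Hypothesis rootH : Root H \subset Z :|: X :|: Y.
Hypothesis nrootH : {in verts H, forall v, v \notin Root H -> v \notin Z}.

Lemma tail_notinZ v w : dir H v w -> v \notin Z.
Proof.
move=> vw; have /andP[vH _] := dir_verts vw; apply: nrootH => //.
by rewrite inE vH /=; apply/forallPn; exists w; rewrite negbK.
Qed.

Lemma edge_sub k v w : edge H k v w -> edge G k v w.
Proof.
by case: subHG => _ sd sb; case: k => /=; [apply: sd|apply: sd|apply: sb].
Qed.

(** The state of an active walk in G that starts in X: the vertex reached and the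
    kind of the last step, which decides what the next step may be.  The last
    clause says that a walk leaving w by its tail has w outside Z; it also covers
    the walk of length zero. *)
Definition reached k w := exists x p,
  [/\ x \in X, x \in verts G, walk G x p, path (open_step G Z) (Backward, x) p
    & last (Backward, x) p = (k, w) /\ (k = Backward -> w \notin Z)].

Lemma reached_start x : x \in X -> x \in verts H -> reached Backward x.
Proof.
case: subHG => /subsetP sv _ _ xX xH; exists x, [::]; split=> //; first exact: sv.
by split=> // _; rewrite (disjointFr dXZ xX).
Qed.

Lemma reached_step k v k' w :
  reached k v -> edge H k' v w -> open_step G Z (k, v) (k', w) -> reached k' w.
Proof.
move=> [x [p [xX xG wp okp [lp _]]]] e okv; exists x, (rcons p (k', w)); split=> //.
- by rewrite -cats1 walk_cat wp -(last_pend Backward) lp /= (edge_sub e).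
- by rewrite rcons_path okp lp.
rewrite last_rcons; split=> // kE; move: e; rewrite kE; exact: tail_notinZ.
Qed.

Lemma reached_up_from_X w x : x \in X -> connect (dir H) w x -> w \in verts H ->
  reached Backward w.
Proof.
move=> xX /connectP[p wp xE]; elim: p w wp xE => [|u p IH] w /=.
  by move=> _ <-; apply: reached_start.
case/andP=> wu up xE wH; have /andP[_ uH] := dir_verts wu.
have ru := IH u up xE uH; apply: (reached_step (k' := Backward) ru wu).
by case: ru => [_ [_ [_ _ _ _ [_ /(_ erefl)]]]].
Qed.

Lemma reached_down_to_Y k w y : y \in Y -> connect (dir H) w y ->
  reached k w -> exists k', reached k' y.
Proof.
move=> yY /connectP[p wp yE]; elim: p w k wp yE => [|u p IH] w k /=.
  by move=> _ -> rw; exists k.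
case/andP=> wu up yE rw; apply: IH up yE _.
apply: (reached_step (k' := Forward) rw wu).
by rewrite /open_step /= andbF (tail_notinZ wu).
Qed.

(** The walk follows the undirected path; at each vertex w, a sink r of H below
    w tells how to go on. *)
Lemma reached_Y k w y :
  y \in Y -> connect (adj H) w y -> w \in verts H -> reached k w ->
  exists k' y', y' \in Y /\ reached k' y'.
Proof.
move=> yY /connectP[p wp yE]; elim: p w k wp yE => [|u p IH] w k /=.
  by move=> _ <- _ rw; exists k, y.
case/andP=> wu up yE wH rw.
have [r wr sr] := acyclic_sink w acH.
have rH : r \in verts H.
  case/connectP: wr => q; elim: q w wH {wu rw} => [|s q IHq] w wH /=.
    by move=> _ ->.
  by case/andP=> /dir_verts /andP[_]; apply: IHq.
have rR : r \in Root H by rewrite inE rH; apply/forallP.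
have uH : u \in verts H.
  by move: wu; rewrite /adj /= => /or3P[/dir_verts|/dir_verts|/bid_verts] /andP[].
have step k0 k' : reached k0 w -> edge H k' w u -> open_step G Z (k0, w) (k', u) ->
    exists k' y', y' \in Y /\ reached k' y'.
  by move=> r0 e o; apply: IH up yE uH (reached_step r0 e o).
have [k' e] : exists k', edge H k' w u.
  by case/or3P: wu => e; [exists Forward|exists Backward|exists Bidirected].
move: (subsetP rootH r rR); rewrite !inE -orbA => /or3P[rZ|rX|rY]; last first.
(* r in Y: the walk ends by going down to r. *)
- by have [k1 r1] := reached_down_to_Y rY wr rw; exists k1, r.
(* r in X: the walk so far is replaced by the one that climbs from r to w; it
   leaves w by a tail, so w is a non-collider whatever the next step is. *)
- have rB := reached_up_from_X rX wr wH; apply: (step _ _ rB e).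
  by case: rB => [_ [_ [_ _ _ _ [_ /(_ erefl)]]]].
(* r in Z: w may be a collider.  If it is not one, an edge of H
   used by the walk has its tail there, or the walk starts there. *)
apply: (step _ _ rw e); rewrite /open_step /=; case: ifP => [_|].
  apply/existsP; exists r; rewrite rZ /=.
  apply: connect_sub wr => a b ab; apply: connect1.
  by case: subHG => _ sd _; apply: sd.
case: k' e => /= [wu' _|e|e]; rewrite ?andbT; first exact: tail_notinZ wu'.
all: case: k rw {step IH} => //= rw _.
all: by case: rw => [_ [_ [_ _ _ _ [_ /(_ erefl)]]]].
Qed.

Lemma reached_not_dsep k y : y \in Y -> reached k y -> ~ dsep G X Y Z.
Proof.
move=> yY [x [p [xX xG wp okp [lp _]]]] ds.
have [q [wq okq eq uq]] := open_walk_shorten wp okp.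
have ey : pend x q = y by rewrite eq -(last_pend Backward) lp.
apply: (ds x q xX); rewrite ?ey //; first by rewrite /is_path xG wq uq.
by apply: open_walk_active okq _; rewrite ey (disjointFr dYZ yY).
Qed.

End StructureToPath.

Lemma n_comp1_connect (T : finType) (G : mgraph T) x y :
  n_comp (adj G) (verts G) = 1 -> x \in verts G -> y \in verts G ->
  connect (adj G) x y.
Proof.
move=> n1 xG yG; have cs := sym_connect_sym (@adj_sym _ G).
have cl : closed (adj G) (verts G).
  apply: intro_closed => // u v.
  by rewrite /adj /= => /or3P[/dir_verts|/dir_verts|/bid_verts] /andP[].
have rG z : z \in verts G -> root (adj G) z \in [predI roots (adj G) & verts G].
  move=> zG; rewrite inE /=; apply/andP; split; first exact: (roots_root cs).
  by rewrite -(closed_connect cl (connect_root _ z)).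
apply/(rootP cs); have [z zE] := mem_card1 n1.
by have := rG _ xG; have := rG _ yG; rewrite !zE !inE => /eqP-> /eqP->.
Qed.

Theorem connects_not_dsep (T : finType) (G H : mgraph T) (X Y Z : {set T}) :
  acyclic (dir H) -> n_comp (adj H) (verts H) = 1 ->
  [disjoint X & Z] -> [disjoint Y & Z] -> connects G H X Y Z -> ~ dsep G X Y Z.
Proof.
move=> acH n1 dXZ dYZ [sub [x xH xX] [y yH yY] rt nrt].
have rx := reached_start sub dXZ xX xH.
have [k [y' [yY' ry]]] :=
  reached_Y acH sub dXZ rt nrt yY (n_comp1_connect n1 xH yH) xH rx.
exact: reached_not_dsep dYZ k y' yY' ry.
Qed.

(** * From an active walk to a structure of interest *)

Definition cut_edge (T : eqType) (e : rel T) (v w : T) : rel T :=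
  [rel a b | e a b && ~~ [|| (a == v) && (b == w) | (a == w) && (b == v)]].

Definition avoid (T : eqType) (e : rel T) (N : pred T) : rel T :=
  [rel a b | [&& e a b, ~~ N a & ~~ N b]].

Section Cuts.
Variables (T : finType) (e : rel T).

(** Take a for the vertex from which a path from x first enters v: that path
    uses no other edge at v. *)
Lemma cut_edge_last x v :
  connect e x v -> exists a, forall w, w != a -> connect (cut_edge e v w) x v.
Proof.
case/connectP=> p; elim: p x => [|y p IH] x /=; first by move=> _ ->; exists v.
case/andP=> xy yp vE; have [->|xv] := eqVneq x v; first by exists v.
have [yv|yv] := eqVneq y v.
  exists x => w wx; apply: connect1; rewrite /cut_edge /= -yv xy yv.
  by rewrite (negPf xv) (eq_sym x w) (negPf wx).
have [a Ha] := IH y yp vE; exists a => w wa.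
apply: connect_trans (connect1 _) (Ha w wa); rewrite /cut_edge /= xy.
by rewrite (negPf xv) (negPf yv) !andbF.
Qed.

(** Stop a path from x to v at its first visit of N or of v. *)
Lemma connect_avoid (N : pred T) x v :
  ~~ N v -> connect e x v ->
  connect (avoid e N) x v \/
  exists2 t, N t & connect (avoid e (pred1 v)) x t.
Proof.
move=> Nv /connectP[p]; elim: p x => [|y p IH] x /=.
  by move=> _ ->; left; apply: connect0.
case/andP=> xy yp vE; have [xN|xN] := boolP (N x).
  by right; exists x => //; apply: connect0.
have [->|xv] := eqVneq x v; first by left; apply: connect0.
have [yv|yv] := eqVneq y v.
  by left; apply: connect1; rewrite /avoid /= -yv xy xN yv Nv.
have exy : avoid e (pred1 v) x y by rewrite /avoid /= xy xv yv.
have [yN|yN] := boolP (N y); first by right; exists y => //; apply: connect1.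
case: (IH y yp vE) => [c|[t tN c]].
  by left; apply: connect_trans (connect1 _) c; rewrite /avoid /= xy xN yN.
by right; exists t => //; apply: connect_trans (connect1 exy) c.
Qed.

End Cuts.

Section MinimalStructure.
Variables (T : finType) (G : mgraph T) (X Y Z : {set T}) (x y : T).
Hypothesis admgG : admg G.

Let targets := Z :|: X :|: Y.

(** A candidate subgraph of G, given by its vertices, directed edges and
    bidirected edges.  These triples form a finite type, over which a smallest
    good candidate exists; edges with an end outside the vertex set are ignored,
    so that deleting vertices only changes the first component. *)
Definition parts : Type := ({set T} * {set T * T} * {set T * T})%type.
Implicit Types c : parts.

Section OfParts.
Variable c : parts.
Definition dir_of : rel T :=
  [rel a b | [&& a \in c.1.1, b \in c.1.1 & (a, b) \in c.1.2]].
(** Deleting one orientation of a bidirected edge from the third component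
    deletes the edge. *)
Definition bid_of : rel T :=
  [rel a b | [&& a \in c.1.1, b \in c.1.1, (a, b) \in c.2 & (b, a) \in c.2]].
Lemma dir_of_verts a b : dir_of a b -> (a \in c.1.1) && (b \in c.1.1).
Proof. by case/and3P=> -> ->. Qed.
Lemma bid_of_verts a b : bid_of a b -> (a \in c.1.1) && (b \in c.1.1).
Proof. by case/and4P=> -> ->. Qed.
Lemma bid_of_sym : symmetric bid_of.
Proof.
move=> a b; rewrite /bid_of /=; case: (a \in c.1.1); case: (b \in c.1.1) => //=.
by rewrite andbC.
Qed.
Definition graph_of : mgraph T := MGraph dir_of_verts bid_of_verts bid_of_sym.
End OfParts.
Arguments dir_of _ _ _ /.
Arguments bid_of _ _ _ /.

Definition induced_parts (S : {set T}) : parts :=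
  (S, [set e | dir G e.1 e.2 & e.1 \notin Z], [set e | bid G e.1 e.2]).

Definition weight c := #|c.1.1| + #|c.1.2| + #|c.2|.

(** Only x and y are required to be connected; minimality removes the other
    components.  Excluding the directed edges out of Z makes every vertex in Z a
    root. *)
Definition good c : bool :=
  [&& c.1.2 \subset (induced_parts setT).1.2, c.2 \subset (induced_parts setT).2,
      c.1.1 \subset verts G,
      (x \in c.1.1) && (y \in c.1.1), connect (adj (graph_of c)) x y
    & [forall v in c.1.1, (v \in targets) || [exists w, dir (graph_of c) v w]]].

Section Minimal.
Variables (S : {set T}) (D B : {set T * T}).
Local Notation c := ((S, D, B) : parts).
Hypothesis good_c : good c.
Hypothesis min_c : forall c', good c' -> weight c <= weight c'.
Let H := graph_of c.
Let e := adj H.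

Lemma min_sub : subgraph H G.
Proof.
case/and5P: good_c => /subsetP sD /subsetP sB sS _ _; split=> // a b /=.
  by case/and3P=> _ _ /sD; rewrite inE => /andP[].
by case/and4P=> _ _ /sB; rewrite inE.
Qed.

Lemma min_dir_notZ a b : dir H a b -> a \notin Z.
Proof.
case/and5P: good_c => /subsetP sD _ _ _ _.
by case/and3P=> _ _ /sD; rewrite inE => /andP[].
Qed.

Lemma min_xS : x \in S. Proof. by case/and5P: good_c => _ _ _ /andP[]. Qed.
Lemma min_yS : y \in S. Proof. by case/and5P: good_c => _ _ _ /andP[]. Qed.
Lemma min_xy : connect e x y. Proof. by case/and5P: good_c => _ _ _ _ /andP[]. Qed.
Lemma min_adj_connect_sym : connect_sym e.
Proof. exact/sym_connect_sym/adj_sym. Qed.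

Lemma min_child v : v \in S -> v \notin targets -> exists w, dir H v w.
Proof.
case/and5P: good_c => _ _ _ _ /andP[_ /forallP/(_ v)] ch vS vR.
by move: ch; rewrite vS (negPf vR) => /existsP.
Qed.

Lemma min_acyclic : acyclic (dir H).
Proof.
apply: (@acyclic_rank _ _ (num_anc (dir G))) => a b ab; apply: num_anc_lt.
  by case: admgG.
by case: min_sub => _ sd _; apply: sd.
Qed.

Lemma min_cycle a b : dir H a b -> ~~ connect (dir H) b a.
Proof.
by move=> ab; move/forallP/(_ a)/forallP/(_ b)/implyP: min_acyclic; apply.
Qed.

(** Minimality against deletion of vertices.  The remaining set is closed under
    children, so no vertex becomes a new sink. *)
Lemma min_verts (S' : {set T}) :
    S' \subset S -> x \in S' -> y \in S' ->
    {in S', forall v w, dir H v w -> w \in S'} ->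
    connect (avoid e [pred t | t \notin S']) x y ->
  S' = S.
Proof.
move=> sS xS' yS' cl cxy; apply/eqP; rewrite eqEcard sS /=.
have: good (S', D, B).
  case/and5P: good_c => sD sB sSG _ /andP[_ ch].
  rewrite /good /= in sD sB sSG *.
  rewrite sD sB (subset_trans sS sSG) xS' yS' /=; apply/andP; split.
    apply: connect_sub cxy => a b /and3P[]; rewrite /= !negbK => ab aS bS.
    apply: connect1; move: ab; rewrite /e /adj /=. rewrite aS bS.
    by rewrite !(subsetP sS).
  apply/forallP=> v; apply/implyP=> vS'; have vS := subsetP sS v vS'.
  have [//|vR] := boolP (v \in targets); have [w vw] := min_child vS vR.
  apply/existsP; exists w; rewrite vS' (cl v vS' w vw) /=.
  by case/and3P: vw.
by move/min_c; rewrite /weight /= -!addnA leq_add2r.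
Qed.

Lemma min_connected v : v \in S -> connect e x v.
Proof.
move=> vS; pose S' := [set t in S | connect e x t].
suff SE : S' = S by move: vS; rewrite -{1}SE inE => /andP[].
apply: min_verts.
- by apply/subsetP=> t; rewrite inE => /andP[].
- by rewrite inE min_xS connect0.
- by rewrite inE min_yS min_xy.
- move=> t; rewrite !inE => /andP[tS xt] w tw.
  have wS : w \in S by case/and3P: tw.
  rewrite inE wS; apply: connect_trans xt (connect1 _).
  by apply/or3P; apply: Or31.
case: (@connect_avoid _ e [pred t | t \notin S'] x y) => //.
- by rewrite /= inE min_yS min_xy.
- exact: min_xy.
case=> t /= tS xt; case/negP: tS; rewrite inE.
have {}xt : connect e x t.
  by apply: connect_sub xt => a b /and3P[ab _ _]; apply: connect1.
rewrite xt andbT; case/connectP: xt => p.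
case/lastP: p => [|p u]; first by move=> _ ->; apply: min_xS.
rewrite rcons_path last_rcons => /andP[_ pu] ->.
by move: pu; rewrite /e /adj /= => /or3P[] /and3P[].
Qed.

(** Minimality against deletion of the edge from v to w: the other child w' of v
    prevents v from becoming a sink, so x and y must get separated.  The relation
    e' stands for any adjacency that survives the deletion; it is all of e when v
    and w are also joined by a bidirected edge. *)
Lemma min_cut_dir v w w' (e' : rel T) :
    dir H v w -> dir H v w' -> w != w' ->
    subrel e' (adj (graph_of (S, D :\ (v, w), B))) -> ~~ connect e' x y.
Proof.
move=> vw vw' ww' se'; apply/negP=> cxy.
have: good (S, D :\ (v, w), B).
  case/and5P: good_c => sD sB sSG /andP[xS yS] /andP[_ ch].
  rewrite /good /= in sD sB sSG *.
  rewrite (subset_trans (subsetDl _ _) sD) sB sSG xS yS /=; apply/andP; split.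
    by apply: connect_sub cxy => a b /se' ab; apply: connect1.
  apply/forallP=> u; apply/implyP=> uS.
  have [//|uR] := boolP (u \in targets); apply/existsP => /=.
  have [->|uv] := eqVneq u v.
    exists w'; move: vw'; rewrite !inE => /and3P[-> -> ->].
    by rewrite xpair_eqE eqxx eq_sym ww'.
  have [t ut] := min_child uS uR; exists t; move: ut.
  by rewrite !inE xpair_eqE (negPf uv) => /and3P[-> -> ->].
move/min_c; rewrite /weight /= !(addnAC _ _ #|B|) leq_add2l.
by rewrite (cardsD1 (v, w) D); case/and3P: vw => _ _ ->; rewrite ltnn.
Qed.

Lemma cut_edge_sub_dir v w :
  subrel (cut_edge e v w) (adj (graph_of (S, D :\ (v, w), B))).
Proof.
move=> a b /andP[]; rewrite /e /adj /= !inE !xpair_eqE negb_or => + /andP[n1 n2].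
rewrite n1 [(b == v) && _]andbC n2 /=; done.
Qed.

Lemma min_cut_bid u v : bid H u v -> ~~ connect (cut_edge e v u) x y.
Proof.
move=> uv; apply/negP=> cxy.
have: good (S, D, B :\ (v, u)).
  case/and5P: good_c => sD sB sSG /andP[xS yS] /andP[_ ch].
  rewrite /good /= in sD sB sSG *.
  rewrite (subset_trans (subsetDl _ _) sB) sD sSG xS yS /=; apply/andP; split=> //.
  apply: connect_sub cxy => a b ab; apply: connect1; move: ab.
  rewrite /cut_edge /e /adj /= !inE !xpair_eqE negb_or.
  case/andP=> + /andP[n1 n2]; rewrite n1 [(b == v) && _]andbC n2 /=; done.
move/min_c; rewrite /weight /= leq_add2l.
by rewrite (cardsD1 (v, u) B); case/and4P: uv => _ _ _ ->; rewrite ltnn.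
Qed.

(** The last edge of a path from x to v, from a, and of a path from y to v, from
    b, suffice to keep x and y connected through v.  Every edge from v to a child
    is a cut, so the children of v are exactly a and b.  A bidirected edge into v
    would also be a cut, hence come from a or b and double a directed edge, which
    would then not be a cut.  If v has a parent, the strict ancestors of v can be
    deleted: a path from x (or y) to v meeting such an ancestor t could go down
    from t to v, bypassing the cut. *)
Lemma min_branch v : 1 < outdeg H v ->
  outdeg H v = 2 /\ no_incoming H v.
Proof.
move=> o1; have [w1 [w2 []]] := card_gt1P o1; rewrite !inE => vw1 vw2 w12.
have vS : v \in S by case/and3P: vw1.
have xv := min_connected vS.
have yv : connect e y v.
  by apply: connect_trans xv; rewrite min_adj_connect_sym; apply: min_xy.
have other w : dir H v w -> exists2 w', dir H v w' & w != w'.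
  move=> vw; have [E|wn] := eqVneq w w1; last by exists w1.
  by exists w2; rewrite ?E.
have cs u : connect_sym (cut_edge e v u).
  apply: sym_connect_sym => s t; rewrite /cut_edge /= [e s t]adj_sym.
  by rewrite orbC [(s == u) && _]andbC [(s == v) && _]andbC.
have [a Ha] := cut_edge_last xv; have [b Hb] := cut_edge_last yv.
have cutxy w : w != a -> w != b -> connect (cut_edge e v w) x y.
  by move=> wa wb; apply: connect_trans (Ha w wa) _; rewrite cs Hb.
have ch w : dir H v w -> (w == a) || (w == b).
  move=> vw; have [w' vw' ww'] := other w vw.
  have := min_cut_dir vw vw' ww' (@cut_edge_sub_dir v w).
  by apply: contraNT; rewrite negb_or => /andP[]; apply: cutxy.
have sub : [set w | dir H v w] \subset [set a; b].
  by apply/subsetP=> w; rewrite !inE; apply: ch.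
have o2 : outdeg H v <= #|[set a; b]| by apply: subset_leq_card.
have ab : a != b.
  by apply: contraTneq o2 => ->; rewrite setUid cards1 -ltnNge.
have cE : [set w | dir H v w] = [set a; b].
  by apply/eqP; rewrite eqEcard sub cards2 ab.
have oE : outdeg H v = 2 by rewrite /outdeg cE cards2 ab.
have va : dir H v a by have := set21 a b; rewrite -cE inE.
have vb : dir H v b by have := set22 a b; rewrite -cE inE.
split=> //; apply/forallP=> u; apply/andP; split; last first.
  apply/negP=> uv.
  have : (u == a) || (u == b).
    by apply: contraNT (min_cut_bid uv); rewrite negb_or => /andP[]; apply: cutxy.
  have kill w w' : dir H v w -> dir H v w' -> w != w' -> u != w.
    move=> vw vw' ww'; apply/eqP=> uE.
    suff se : subrel e (adj (graph_of (S, D :\ (v, w), B))).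
      by have := min_cut_dir vw vw' ww' se; rewrite min_xy.
    have bvw : bid H v w by rewrite bid_sym -uE.
    move=> s t st.
    have [/andP[/eqP-> /eqP->]|n1] := boolP ((s == v) && (t == w)).
      by rewrite /adj /=; move: bvw => /= ->; rewrite !orbT.
    have [/andP[/eqP-> /eqP->]|n2] := boolP ((s == w) && (t == v)).
      by rewrite adj_sym /adj /=; move: bvw => /= ->; rewrite !orbT.
    by apply: cut_edge_sub_dir; rewrite /cut_edge /= st negb_or n1 n2.
  by rewrite (negPf (kill a b va vb ab)) (negPf (kill b a vb va _)) // eq_sym.
apply/negP=> uv.
pose N := [pred t | connect (dir H) t v && (t != v)].
(* By acyclicity a directed path to v does not use an edge between v and a
   child of v. *)
have dcut w t : dir H v w -> connect (dir H) t v -> connect (cut_edge e v w) t v.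
  move=> vw /connectP[p]; elim: p t => [|s p IH] t /=; first by move=> _ ->.
  case/andP=> ts sp vE; have [->//|tv] := eqVneq t v.
  apply: connect_trans (connect1 _) (IH s sp vE).
  rewrite /cut_edge /= (negPf tv) /=; apply/andP; split.
    by rewrite /e /adj /=; move: ts => /= ->.
  apply/negP=> /andP[/eqP tw /eqP sv].
  by have /negP := min_cycle vw; apply; apply: connect1; rewrite -tw -sv.
have esc z w : dir H v w -> connect e z v -> ~~ connect (cut_edge e v w) z v ->
    connect (avoid e N) z v.
  move=> vw zv nz; have [|//|[t /andP[tv _] zt]] := connect_avoid (N := N) _ zv.
    by rewrite /= eqxx andbF.
  case/negP: nz; apply: connect_trans (dcut w t vw tv).
  apply: connect_sub zt => s r /and3P[sr sv rv]; apply: connect1.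
  rewrite /= in sv rv.
  by rewrite /cut_edge /= sr (negPf sv) (negPf rv) andbF.
have ncut w : dir H v w -> ~~ connect (cut_edge e v w) x y.
  move=> vw; have [w' vw' ww'] := other w vw.
  exact: min_cut_dir vw vw' ww' (@cut_edge_sub_dir v w).
have xN : connect (avoid e N) x v.
  apply: (esc x a va xv); apply: contra (ncut a va) => xa.
  by apply: connect_trans xa _; rewrite cs; apply: Hb.
have yN : connect (avoid e N) y v.
  apply: (esc y b vb yv); apply: contra (ncut b vb) => yb.
  by apply: connect_trans (Ha b _) _; rewrite ?(eq_sym b) // cs.
have symN : connect_sym (avoid e N).
  apply: sym_connect_sym => s t; rewrite /avoid /= [e s t]adj_sym.
  by rewrite [~~ _ && _]andbC.
have notN z : connect (avoid e N) z v -> ~~ N z.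
  case/connectP=> -[|s p] /=; first by move=> _ <-; rewrite eqxx andbF.
  by case/andP=> /and3P[].
have SE : S :\: [set t | N t] = S.
  apply: min_verts.
  - exact: subsetDl.
  - by rewrite !inE min_xS andbT; apply: notN.
  - by rewrite !inE min_yS andbT; apply: notN.
  - move=> t; rewrite !inE => /andP[tN tS] w tw.
    have wS : w \in S by case/and3P: tw.
    rewrite !inE wS andbT; apply: contra tN => /andP[wv _].
    rewrite (connect_trans (connect1 tw) wv) /=; apply/eqP=> tv.
    by have /negP := min_cycle tw; apply; rewrite tv.
  apply: (@connect_trans _ _ v); last rewrite symN in yN.
    apply: connect_sub xN => s t /and3P[st sN tN]; apply: connect1.
    rewrite /avoid /= st !inE !negbK /=; move: sN tN => /= -> ->.
    by move: st; rewrite /e /adj /= => /or3P[] /and3P[-> ->].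
  apply: connect_sub yN => s t /and3P[st sN tN]; apply: connect1.
  rewrite /avoid /= st !inE !negbK /=; move: sN tN => /= -> ->.
  by move: st; rewrite /e /adj /= => /or3P[] /and3P[-> ->].
have uS : u \in S by case/and3P: uv.
have uNv : u != v.
  by apply/eqP=> uE; have /negP := min_cycle uv; apply; rewrite uE.
by move: uS; rewrite -SE !inE /= uNv (connect1 uv).
Qed.

Lemma min_connects :
  x \in X -> y \in Y -> structure_of_interest H /\ connects G H X Y Z.
Proof.
move=> xX yY; split; split.
- split; first exact: min_acyclic.
  case: admgG => _ nl v; case/andP: (nl v) => nd nb; case: min_sub => _ sd sb.
  by rewrite (contra (sd v v) nd) (contra (sb v v) nb).
- rewrite -(n_comp_connect min_adj_connect_sym x); apply: eq_n_comp_r => v.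
  apply/idP/idP; first exact: min_connected.
  case/connectP=> p; elim/last_ind: p => [|p u _].
    by move=> _ ->; apply: min_xS.
  rewrite rcons_path last_rcons => /andP[_ pu] ->.
  by move: pu; rewrite /e /adj /= => /or3P[] /and3P[].
- move=> v vS; case: leqP => //= o1; have [-> ->] := min_branch o1.
  by rewrite eqxx.
- exact: min_sub.
- by exists x => //; apply: min_xS.
- by exists y => //; apply: min_yS.
- apply/subsetP=> v; rewrite inE => /andP[vS /forallP rv].
  apply: contraT => vR; have [w vw] := min_child vS vR.
  by have := rv w; rewrite vw.
- move=> v vS; rewrite inE (vS : v \in verts H) /= => /forallPn[w].
  by rewrite negbK; apply: min_dir_notZ.
Qed.

End Minimal.

Lemma good_connects c :
  good c -> x \in X -> y \in Y ->
  exists H, structure_of_interest H /\ connects G H X Y Z.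
Proof.
move=> gc xX yY; have [[[S D] B] gm mm] := arg_minnP weight gc.
by exists (graph_of (S, D, B)); apply: min_connects.
Qed.

Let open_dir : rel T := [rel a b | dir G a b && (a \notin Z)].
(** Every vertex of an active path belongs to this set: following tails from a
    non-collider ends at an endpoint or at a collider, which is above Z. *)
Definition openAnc : {set T} :=
  [set v in verts G | [exists r in targets, connect open_dir v r]].

Lemma openAnc_target v : v \in verts G -> v \in targets -> v \in openAnc.
Proof. by move=> vG vR; rewrite inE vG; apply/existsP; exists v; rewrite vR /=. Qed.

Lemma openAnc_step v w : dir G v w -> v \notin Z -> w \in openAnc -> v \in openAnc.
Proof.
move=> vw vZ; rewrite !inE => /andP[_ /existsP[r /andP[rR wr]]].
have /andP[-> _] := dir_verts vw; apply/existsP; exists r; rewrite rR /=.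
by apply: connect_trans (connect1 _) wr; rewrite /open_dir /= vw.
Qed.

Lemma openAnc_descendant v : v \in verts G -> has_descendant G Z v -> v \in openAnc.
Proof.
move=> vG /existsP[z /andP[zZ /connectP[p]]].
elim: p v vG => [|w p IH] v vG /=.
  by move=> _ zv; apply: openAnc_target => //; rewrite /targets !inE -zv zZ.
case/andP=> vw wp zE; have [vZ|vZ] := boolP (v \in Z).
  by apply: openAnc_target => //; rewrite /targets !inE vZ.
apply: (openAnc_step vw vZ); have /andP[_ wG] := dir_verts vw; exact: IH.
Qed.

(** A step into w with an arrowhead leaves three cases: w is the endpoint, or a
    collider, or the walk goes on along an arrow out of w. *)
Lemma openAnc_head k v w p :
  walk G v ((k, w) :: p) -> path (open_step G Z) (k, w) p -> pend w p \in targets ->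
  head_at_target k -> w \in openAnc.
Proof.
elim: p k v w => [|[k' u] p IH] k v w /=.
  by rewrite andbT => /edge_verts /andP[_ wG] _ wR _; apply: openAnc_target.
case/and3P=> vw wu up /andP[o okp] uR hk; move: o; rewrite /open_step /= hk /=.
have /andP[_ wG] := edge_verts vw.
case: ifP => [_|hk' wZ]; first exact: openAnc_descendant.
have kE : k' = Forward by case: (k') hk'.
subst k'; apply: (openAnc_step wu wZ).
by apply: (IH Forward w) => //; rewrite /= in wu *; rewrite wu.
Qed.

Lemma openAnc_connect k v p :
  walk G v p -> path (open_step G Z) (k, v) p -> pend v p \in targets ->
  pend v p \notin Z ->
  v \in openAnc ->
  pend v p \in openAnc /\
  connect (adj (graph_of (induced_parts openAnc))) v (pend v p).
Proof.
elim: p k v => [|[k' w] p IH] k v; first by move=> *; split.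
move=> wp okp eR eZ va.
have /= /andP[vw wq] := wp; have /= /andP[okv okq] := okp.
have wZ : k' = Backward -> w \notin Z.
  move=> kE; case: p okq eZ {IH wp okp eR wq} => [//|t p] /andP[+ _] _.
  by rewrite kE.
have vZ : k' = Forward -> v \notin Z.
  by move=> kE; move: okv; rewrite kE /open_step /= andbF.
have wa : w \in openAnc.
  have [hk|] := boolP (head_at_target k'); first exact: openAnc_head wp okq eR hk.
  by case: (k') vw wZ => //= wv wZ _; apply: openAnc_step wv (wZ _) va.
have [ea wc] := IH k' w wq okq eR eZ wa; split=> //.
apply: connect_trans (connect1 _) wc; rewrite /adj /= va wa !inE /=.
case: k' vw wZ vZ {wp okp okv okq eR eZ} => /= vw wZ vZ.
- by rewrite vw vZ.
- by rewrite vw wZ ?orbT.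
- by rewrite vw bid_sym vw !orbT.
Qed.

Lemma openAnc_good p :
  walk G x p -> path (open_step G Z) (Backward, x) p -> pend x p = y ->
  x \in verts G -> x \in X -> y \in Y ->
  x \notin Z -> y \notin Z -> good (induced_parts openAnc).
Proof.
move=> wp okp ey xG xX yY xZ yZ.
have xa : x \in openAnc.
  by apply: openAnc_target => //; rewrite /targets !inE xX orbT.
have := openAnc_connect wp okp; rewrite ey => /(_ _ yZ xa).
case; first by rewrite /targets !inE yY orbT.
move=> ya cxy; apply/and5P; split=> //.
- by apply/subsetP=> v; rewrite inE => /andP[].
- exact/andP.
apply/andP; split=> //; apply/forallP=> v; apply/implyP=> /= va.
have [//|vR] := boolP (v \in targets); apply/existsP.
case/setIdP: (va) => vG /existsP[r /andP[rR /connectP[[|w q] /=]]].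
  by move=> _ rE; rewrite -rE rR in vR.
case/andP=> /andP[vw vZ] wq rE; exists w.
have wa : w \in openAnc.
  rewrite inE; have /andP[_ ->] := dir_verts vw.
  by apply/existsP; exists r; rewrite rR; apply/connectP; exists q.
by rewrite /= va wa inE /= vw.
Qed.

End MinimalStructure.

Theorem walk_connects (T : finType) (G : mgraph T) (X Y Z : {set T}) x p :
  admg G -> [disjoint X & Z] -> [disjoint Y & Z] ->
  x \in verts G -> x \in X -> pend x p \in Y -> walk G x p ->
  path (open_step G Z) (Backward, x) p ->
  exists H, structure_of_interest H /\ connects G H X Y Z.
Proof.
move=> ag dXZ dYZ xG xX yY wp okp.
apply: (good_connects ag (openAnc_good wp okp erefl xG xX yY _ _)) => //.
  by rewrite (disjointFr dXZ xX).
by rewrite (disjointFr dYZ yY).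
Qed.

(** * Sorting a compatible graph inside each cluster *)

Section Relabel.
Variables (T : finType) (G : mgraph T) (f g : T -> T).
Hypotheses (fK : cancel f g).

Lemma pullback_dir_verts x y :
  dir G (g x) (g y) ->
  (x \in [set v | g v \in verts G]) && (y \in [set v | g v \in verts G]).
Proof. by rewrite !inE; apply: dir_verts. Qed.

Lemma pullback_bid_verts x y :
  bid G (g x) (g y) ->
  (x \in [set v | g v \in verts G]) && (y \in [set v | g v \in verts G]).
Proof. by rewrite !inE; apply: bid_verts. Qed.

Lemma pullback_bid_sym : symmetric (fun x y => bid G (g x) (g y)).
Proof. by move=> x y; apply: bid_sym. Qed.

(** The graph G with each vertex v renamed to f v, when g is the inverse of f. *)
Definition pullback : mgraph T :=
  MGraph pullback_dir_verts pullback_bid_verts pullback_bid_sym.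

Definition map_step (s : edge_kind * T) := (s.1, f s.2).

Lemma walk_pullback x p : walk G x p -> walk pullback (f x) (map map_step p).
Proof.
elim: p x => [|[k w] p IH] x //= /andP[xw wp]; rewrite IH // andbT.
by case: k xw => /=; rewrite !fK.
Qed.

Lemma pend_map x p : pend (f x) (map map_step p) = f (pend x p).
Proof. by elim: p x => [|[k w] p IH] x //=; apply: IH. Qed.

Lemma open_step_pullback (Z Z' : {set T}) s t :
  (forall v, (f v \in Z') = (v \in Z)) ->
  open_step G Z s t -> open_step pullback Z' (map_step s) (map_step t).
Proof.
move=> fZ; rewrite /open_step /= fZ; case: ifP => // _ /existsP[z /andP[zZ sz]].
apply/existsP; exists (f z); rewrite fZ zZ /=.
case/connectP: sz => p; elim: p s.2 => [|w p IH] u /=.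
  by move=> _ ->; apply: connect0.
case/andP=> uw wp zE; apply: connect_trans (connect1 _) (IH w wp zE).
by rewrite /= !fK.
Qed.

End Relabel.

Lemma micro_disjoint (K : finType) (C : cluster_dag K) (X Z : {set K}) :
  [disjoint X & Z] -> [disjoint micro C X & micro C Z].
Proof.
move=> d; apply/pred0P=> v; apply/negP; rewrite /= !inE => /andP[vX].
by rewrite (disjointFr d vX).
Qed.

Section Compatible.
Variables (K : finType) (C : cluster_dag K).
Implicit Types (u v w a b : var C) (G H : mgraph (var C)).

Lemma compatible_dir G u v :
  compatible G -> dir G u v -> dir C (cluster u) (cluster v).
Proof.
case=> [[[_ nl] _] cd _ cs _]; case: u v => A i [B j].
move: j; have [<-|AB] := eqVneq A B => j.
  move=> ij; apply/cs; exists i, j; split=> //; apply: contraTneq ij => ->.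
  by case/andP: (nl (mkvar j)).
by move=> ij; apply/(cd A B AB); exists i, j.
Qed.

Lemma compatible_bid G u v :
  compatible G -> bid G u v -> min_bid u v.
Proof.
case=> [[[_ nl] _] _ cb _ cs]; move=> uv; apply/andP; split; last first.
  by apply: contraTneq uv => ->; case/andP: (nl v).
case: u v uv => A i [B j].
move: j; have [<-|AB] := eqVneq A B => j.
  move=> ij; apply/cs; exists i, j; split=> //; apply: contraTneq ij => ->.
  by case/andP: (nl (mkvar j)).
by move=> ij; apply/(cb A B AB); exists i, j.
Qed.

Lemma unf_dir_cluster a b : unf_dir a b -> dir C (cluster a) (cluster b).
Proof. by case/orP=> /andP[]. Qed.

(** Admissibility serves to know that a cluster with a self-loop has at least
    two variables, so that the minimal graph represents that self-loop. *)
Lemma compatible_union H :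
  admissible C -> subgraph H (Gunf C) -> acyclic (dir (union (Gmin C) H)) ->
  compatible (union (Gmin C) H).
Proof.
move=> [G0 [_ _ _ ad ab]] [_ sd sb] ac.
have dC a b : dir (union (Gmin C) H) a b -> dir C (cluster a) (cluster b).
  by case/orP=> [/andP[] //|/sd]; apply: unf_dir_cluster.
have bC a b : bid (union (Gmin C) H) a b -> min_bid a b by case/orP=> [|/sb].
have index0 A : exists i : 'I_(csize C A), val i == 0.
  by exists (Ordinal (csize_gt0 C A)).
split.
- split; last by rewrite /= setTU.
  split=> // x; apply/andP; split; apply/negP.
    move/forallP/(_ x)/forallP/(_ x)/implyP: ac => ac /ac.
    by rewrite connect0.
  by move/bC=> /andP[_]; rewrite eqxx.
- move=> A B AB; split; last by case=> i [j] /dC.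
  move=> CAB; have [i i0] := index0 A.
  have jB : (csize C B).-1 < csize C B by rewrite prednK ?csize_gt0.
  exists i, (Ordinal jB); apply/orP; left; rewrite /= /min_dir /= CAB (negPf AB).
  rewrite andTb; apply/andP; split; first exact: i0.
  by rewrite /index_in /= prednK ?csize_gt0 // eqxx.
- move=> A B AB; split; last by case=> i [j] /bC /andP[].
  move=> CAB; have [i _] := index0 A; have [j _] := index0 B.
  exists i, j; rewrite /= /min_bid /= CAB /=; apply/orP; left.
  by apply: contraNneq AB => /(congr1 (@cluster _ C)) /= ->.
- move=> A; split; last by case=> i [j [_ /dC]].
  move=> CA; have [i [j [ij _]]] := (ad A).1 CA.
  have [lt|gt|E] := ltngtP (val i) (val j); last by case/eqP: ij; apply: val_inj.
    by exists i, j; split=> //; apply/orP; left;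
    rewrite /= /min_dir /= CA eqxx; apply: lt.
  by exists j, i; rewrite eq_sym; split=> //; apply/orP; left;
    rewrite /= /min_dir /= CA eqxx; apply: gt.
- move=> A; split; last by case=> i [j [_ /bC /andP[]]].
  move=> CA; have [i [j [ij _]]] := (ab A).1 CA.
  exists i, j; split=> //; rewrite /= /min_bid /= CA /=; apply/orP; left.
  by apply: contraNneq ij => E; apply/eqP; apply: eq_from_Tagged E.
Qed.

Section Sorted.
Variable G : mgraph (var C).
Hypothesis compG : compatible G.

Lemma compatible_acyclic : acyclic (dir G).
Proof. by case: compG => -[[]]. Qed.

(** A topological order of G; the second summand breaks ties, so that it is
    total on each cluster. *)
Definition topo_rank v := num_anc (dir G) v * #|{: var C}| + enum_rank v.

Lemma topo_rank_inj : injective topo_rank.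
Proof.
move=> u v /(congr1 (modn^~ #|{: var C}|)); rewrite !modnMDl !modn_small //.
by move=> /val_inj /enum_rank_inj.
Qed.

Lemma topo_rank_dir u v : dir G u v -> topo_rank u < topo_rank v.
Proof.
move=> /(num_anc_lt compatible_acyclic) uv.
apply: (@leq_trans ((num_anc (dir G) u).+1 * #|{: var C}|)).
  by rewrite mulSnr ltn_add2l.
by apply: leq_trans (leq_addr _ _); rewrite leq_mul2r uv orbT.
Qed.

Definition cluster_pos v :=
  #|[set w | (cluster w == cluster v) && (topo_rank w < topo_rank v)]|.

Lemma cluster_pos_lt v : cluster_pos v < csize C (cluster v).
Proof.
have le : #|[set w : var C | cluster w == cluster v]| <= csize C (cluster v).
  move: (cluster v) => A; rewrite -[X in _ <= X]card_ord.
  apply: leq_trans (leq_imset_card (@mkvar _ C A) _).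
  apply: subset_leq_card; apply/subsetP=> -[B i]; rewrite inE => /eqP /= BA.
  by subst B; apply/imsetP; exists i.
apply: leq_trans le; apply: proper_card; apply/properP; split.
  by apply/subsetP=> w; rewrite !inE => /andP[].
by exists v; rewrite !inE ?eqxx // ltnn.
Qed.

Lemma cluster_pos_mono u v :
  cluster u = cluster v ->
  (cluster_pos u < cluster_pos v) = (topo_rank u < topo_rank v).
Proof.
have le (s t : var C) : cluster s = cluster t -> topo_rank s <= topo_rank t ->
    cluster_pos s <= cluster_pos t.
  move=> st rst; apply: subset_leq_card; apply/subsetP=> w; rewrite !inE st.
  by case/andP=> -> /leq_trans->.
move=> uv; apply/idP/idP; first by apply: contraTT; rewrite -!leqNgt; apply: le.
move=> ruv; apply: proper_card; apply/properP; split.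
  by apply/subsetP=> w; rewrite !inE uv => /andP[-> /ltn_trans->].
by exists u; rewrite !inE ?uv ?eqxx ?ltnn ?andbF.
Qed.

Definition resort v : var C := mkvar (Ordinal (cluster_pos_lt v)).

Lemma resort_inj : injective resort.
Proof.
move=> u v E; have cE : cluster u = cluster v := congr1 (@cluster _ C) E.
have pE : cluster_pos u = cluster_pos v := congr1 (@index_in _ C) E.
have := cluster_pos_mono cE; have := cluster_pos_mono (esym cE); rewrite pE ltnn.
by case: (ltngtP (topo_rank u) (topo_rank v)) => // rE _ _; apply: topo_rank_inj.
Qed.

(** Inside a cluster this is the choice of indices.  From a cluster to another,
    u is the lowest of its cluster and v the highest of its own, and some edge of
    G goes from the first cluster to the second. *)
Lemma min_dir_resort u v :
  min_dir (resort u) (resort v) -> topo_rank u < topo_rank v.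
Proof.
case/andP=> Cuv; case: ifP => [/eqP cE|/negbT cN].
  by rewrite -cluster_pos_mono.
case/andP=> /eqP u0 /eqP vl; case: (compG) => _ cd _ _ _.
have [i [j ij]] := (cd _ _ cN).1 Cuv.
apply: leq_trans (_ : topo_rank (mkvar j) <= _).
  apply: leq_ltn_trans (topo_rank_dir ij); rewrite leqNgt -cluster_pos_mono //.
  by rewrite -[cluster_pos u]/(index_in (resort u)) u0.
rewrite leqNgt -cluster_pos_mono //.
apply/negP=> /leq_ltn_trans/(_ (cluster_pos_lt _)).
by rewrite -[X in X.+2]/(index_in (resort v)) vl ltnn.
Qed.

Definition unsort := invF resort_inj.
Definition sortedG := pullback G unsort.

Lemma topo_rank_min_dir a b :
  min_dir a b -> topo_rank (unsort a) < topo_rank (unsort b).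
Proof.
rewrite -{1}(f_invF resort_inj a) -{1}(f_invF resort_inj b).
exact: min_dir_resort.
Qed.

Lemma cluster_unsort a : cluster (unsort a) = cluster a.
Proof. by rewrite -{2}(f_invF resort_inj a). Qed.

Lemma admg_sorted : admg sortedG.
Proof.
split; first apply: (@acyclic_rank _ _ (topo_rank \o unsort)) => a b.
  exact: topo_rank_dir.
by move=> a; case: compG => -[[_ nl] _] _ _ _ _; apply: nl.
Qed.

Lemma sorted_sub : subgraph sortedG (Gunf C).
Proof.
split; first exact: subsetT.
- move=> a b ab; apply/orP; right; apply/andP; split.
    by have := compatible_dir compG ab; rewrite !cluster_unsort.
  apply: (@acyclic_rank _ _ (topo_rank \o unsort)) => c d /=.
  case/orP=> [/topo_rank_min_dir //|/andP[/eqP-> /eqP->]]; exact: topo_rank_dir.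
- move=> a b /(compatible_bid compG) /andP[]; rewrite !cluster_unsort => ab n.
  by rewrite /= /min_bid /= ab /=; apply: contraNneq n => ->.
Qed.

Lemma acyclic_union_sorted H : subgraph H sortedG ->
  acyclic (dir (union (Gmin C) H)).
Proof.
case=> _ sd _; apply: (@acyclic_rank _ _ (topo_rank \o unsort)) => a b /=.
by case/orP=> [/topo_rank_min_dir //|/sd /topo_rank_dir].
Qed.

Lemma resort_micro S v : (resort v \in micro C S) = (v \in micro C S).
Proof. by rewrite !inE. Qed.

End Sorted.
End Compatible.

(** * The equivalence *)

Theorem theorem3 (K : finType) (C : cluster_dag K) (X Y Z : {set K})
    (adm : admissible C)
    (dXY : [disjoint X & Y]) (dXZ : [disjoint X & Z]) (dYZ : [disjoint Y & Z]) :
  (exists2 G : mgraph (var C), compatible G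
     & ~ dsep G (micro C X) (micro C Y) (micro C Z))
  <->
  (exists sigma : mgraph (var C),
     [/\ structure_of_interest sigma,
         connects (Gunf C) sigma (micro C X) (micro C Y) (micro C Z)
       & acyclic (dir (union (Gmin C) sigma))]).
Proof.
have dXZ' := micro_disjoint C dXZ; have dYZ' := micro_disjoint C dYZ.
split=> [[G cG nds]|[H [[[acH _] n1 _] con ac]]]; last first.
  have [sub hX hY rt nrt] := con.
  exists (union (Gmin C) H); first exact: compatible_union.
  apply: (@connects_not_dsep _ _ H) => //; split=> //; split.
  - exact: subsetUr.
  - by move=> a b /= ->; rewrite orbT.
  - by move=> a b /= ->; rewrite orbT.
have [x [p [xX yY pth act]]] : exists x p,
  [/\ x \in micro C X, pend x p \in micro C Y, is_path G x p
    & active G (micro C Z) x p].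
  apply: Classical_Prop.NNPP => ne; apply: nds => x p xX yY pth act.
  by apply: ne; exists x, p.
have /and3P[xG wp up] := pth; have okp := active_open_walk up act.
pose f := resort G; pose F := map_step f.
have fK : cancel f (unsort G) := invF_f _.
have fS S v : (f v \in micro C S) = (v \in micro C S) := resort_micro G S v.
have okF : path (open_step (sortedG G) (micro C Z)) (Backward, f x) (map F p).
  rewrite -[(Backward, f x)]/(F (Backward, x)); move: okp.
  elim: p (Backward, x) {pth act wp up yY} => [|t p IH] s //= /andP[st /IH ->].
  by rewrite andbT; apply: open_step_pullback st.
have [|||H [soi con]] := walk_connects (admg_sorted cG) dXZ' dYZ' _ _ _
  (walk_pullback fK wp) okF.
- by rewrite inE fK.
- by rewrite fS.
- by rewrite pend_map fS.
have [sub hX hY rt nrt] := con.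
exists H; split=> //; last exact: acyclic_union_sorted sub.
by split=> //; apply: subgraph_trans sub (sorted_sub cG).
Qed.
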